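(* Let $n\ge 1$ and $t\ge 1$ be integers and let $S$ be a $t$-fold $n$-spread of $\mathbb{F}_q^{2n}$. Define $v_S$ on the set of chambers of $\mathbb{F}_q^{2n}$ by $v_S(C)=1$ if $C_n\in S$ and $v_S(C)=0$ otherwise. Then $v_S$ is an antidesign of $\Gamma_{2n}(q)$, and $\mathds{1}^\top v_S=t(q^n+1)z_n(q)^2$.
   Context: A chamber of $\mathbb{F}_q^{2n}$ is a set $C=\{C_1,\dots,C_{2n-1}\}$ of subspaces with $C_1\subset\cdots\subset C_{2n-1}$, $\dim C_i=i$. Chambers $C,D$ are opposite if $C_i\cap D_{2n-i}=\{0\}$ for all $i$. $\Gamma_{2n}(q)$ is the graph whose vertices are the chambers of $\mathbb{F}_q^{2n}$, two chambers adjacent iff opposite. Functions from the vertex set to $\mathbb{Q}$ are identified with vectors indexed by chambers; $\mathds{1}$ is the all-ones vector. An antidesign of $\Gamma_{2n}(q)$ is a function $v$ from the chambers to $\mathbb{Q}$ with $e^\top v=0$ for every vector $e$ in the eigenspace of the adjacency matrix of $\Gamma_{2n}(q)$ for its smallest eigenvalue. A $t$-fold $n$-spread of $\mathbb{F}_q^{2n}$ is a set $S$ of $n$-dimensional subspaces such that every $1$-dimensional subspace lies in exactly $t$ members of $S$. $z_n(q)$ denotes the number of chambers of $\mathbb{F}_q^n$, i.e. $z_n(q)=(q-1)^{-n}\prod_{i=1}^n(q^i-1)$. *)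

(* Defs.v *)
From HB Require Import structures.
From mathcomp Require Import all_boot all_order all_algebra.

Set Implicit Arguments.
Unset Strict Implicit.
Unset Printing Implicit Defensive.

Import Order.TTheory GRing.Theory Num.Theory.

Local Open Scope ring_scope.

(* A subspace is stored as its canonical generating matrix, so over a finite
   field there are finitely many of them. *)
Section FiniteSubspaces.
Import VectorInternalTheory.
Variables (F : finFieldType) (vT : vectType F).

HB.instance Definition _ := [Countable of {vspace vT} by <:].
HB.instance Definition _ := [Finite of {vspace vT} by <:].

End FiniteSubspaces.

Section Chambers.
Variables (F : finFieldType) (m : nat).

(* The set {C_1, ..., C_(m-1)} is listed by increasing dimension; the listing
   and the set determine each other. *)
Definition is_chamber (s : (m.-1).-tuple {vspace 'rV[F]_m}) : bool :=
  sorted (fun U W : {vspace 'rV[F]_m} => (U <= W)%VS) s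
  && ([seq \dim U | U <- s] == iota 1 m.-1).

Definition chamber := {s : (m.-1).-tuple {vspace 'rV[F]_m} | is_chamber s}.

HB.instance Definition _ := Finite.on chamber.

(* C_i, meaningful for 0 < i < m; the sequence C is numbered from 0. *)
Definition chamber_nth (C : chamber) (i : nat) : {vspace 'rV[F]_m} :=
  nth 0%VS (val C) i.-1.

Definition opposite (C D : chamber) : bool :=
  [forall i : 'I_m, (0 < i)%N ==>
     ((chamber_nth C i :&: chamber_nth D (m - i))%VS == 0%VS)].

End Chambers.

Definition adjacency_mx (R : nzRingType) (T : finType) (adj : rel T) :
    'M[R]_#|T| :=
  \matrix_(i, j) (adj (enum_val i) (enum_val j))%:R.

Definition smallest_eigenvalue (R : rcfType) (d : nat) (A : 'M[R]_d) (a : R) :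
    Prop :=
  eigenvalue A a /\ forall b : R, eigenvalue A b -> a <= b.

(* For m = 2n the graph is Gamma_{2n}(q). The smallest eigenvalue need not be
   rational a priori, so eigenvectors are taken over a real closed field R;
   a real symmetric matrix of positive size does have a smallest eigenvalue.
   Library eigenspaces consist of row vectors, which agree with column
   eigenvectors because the adjacency matrix is symmetric. *)
Definition antidesign (R : rcfType) (F : finFieldType) (m : nat)
    (v : chamber F m -> rat) : Prop :=
  let A := adjacency_mx R (@opposite F m) in
  forall (a : R) (e : 'rV[R]_#|{: chamber F m}|),
    smallest_eigenvalue A a -> (e <= eigenspace A a)%MS ->
    e *m (\col_i ratr (v (enum_val i))) = 0.

Definition fold_spread (F : finFieldType) (n t : nat)
    (S : {set {vspace 'rV[F]_(2 * n)}}) : Prop :=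
  (forall U, U \in S -> \dim U = n) /\
  (forall P : {vspace 'rV[F]_(2 * n)}, \dim P = 1%N ->
     #|[set U in S | (P <= U)%VS]| = t).

Definition spread_vec (F : finFieldType) (n : nat)
    (S : {set {vspace 'rV[F]_(2 * n)}}) (C : chamber F (2 * n)) : rat :=
  (chamber_nth C n \in S)%:R.

Definition num_chambers (F : finFieldType) (n : nat) : nat :=
  #|{: chamber F n}|.

(* Main.v *)
Require Import Defs.
From HB Require Import structures.
From mathcomp Require Import all_boot all_order all_algebra finfield zify ring.

Set Implicit Arguments.
Unset Strict Implicit.
Unset Printing Implicit Defensive.

Import Order.TTheory GRing.Theory Num.Theory.

Local Open Scope ring_scope.

(** Let [K] be the operator [(K g) U = \sum_(W complement of U) g W] on functions
    of the [n]-subspaces. Since the number of chambers [C] with [C_n = W] that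
    are opposite to [D] is a constant [c] if [W] is a complement of [D_n] and [0]
    otherwise, an eigenvector [e] of the opposition graph for [a], summed over
    the chambers with a given middle subspace, becomes an eigenvector of [K] for
    [a / c] (or [0]), and eigenvectors of [K] pull back to the graph.

    Functions of the form [U |-> \sum_(I <= U, dim I <= j) f I] increase with [j]
    up to all functions, and by Möbius inversion [K] acts on the [j]-th quotient
    as the scalar [theta_j = (-1)^j q^('C(j,2) + n(n-j))], whose minimum is
    [theta_1], attained only there. As [c theta_1] is an eigenvalue of the graph,
    the smallest one satisfies [a / c <= theta_1]; so the image of [e] vanishes
    or is [U |-> f 0 + \sum_(P <= U) f P] over points [P], where the eigenvalue
    equation forces [\sum_P f P = - (q^n + 1) f 0]. Its sum over a [t]-fold
    spread [S] is [#|S| f 0 + t \sum_P f P], and [#|S| = t (q^n + 1)]. *)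

(** * Counting subspaces of a finite vector space *)

Section SubspaceCounting.

Variables (F : finFieldType) (m : nat).
Local Notation q := #|F|.
Local Notation V := 'rV[F]_m.
Implicit Types (U W X Y J L : {vspace V}) (v w : V).

Lemma card_vspaceD X Y : (X <= Y)%VS ->
  #|[set w in Y | w \notin X]| = (q ^ \dim Y - q ^ \dim X)%N.
Proof.
move=> sXY; have cardE (Z : {vspace V}) : #|[set w in Z]| = (q ^ \dim Z)%N.
  by rewrite -card_vspace; apply: eq_card => w; rewrite inE.
have -> : [set w in Y | w \notin X] = [set w in Y] :\: [set w in X].
  by apply/setP=> w; rewrite !inE andbC.
rewrite cardsD cardE; congr (_ - _)%N; rewrite -cardE.
by apply: eq_card => w; rewrite !inE; apply/andb_idl/subvP.
Qed.

Lemma dim_addv_line X v : v \notin X -> \dim (X + <[v]>)%VS = (\dim X).+1.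
Proof.
move=> vX; rewrite dimv_disjoint_sum ?dim_vline.
  by case: eqP vX => [->|]; rewrite ?mem0v // addn1.
apply/eqP; rewrite -subv0; apply/subvP=> w /memv_capP[wX /vlineP[k wE]].
rewrite memv0; apply: contraR vX => w0.
have k0 : k != 0 by apply: contraNneq w0 => k0; rewrite wE k0 scale0r.
by rewrite -[v](scalerK k0) -wE memvZ.
Qed.

Lemma compl_addv Y U W : (U <= Y)%VS -> (W <= Y)%VS ->
  (W :&: U = 0)%VS -> \dim W = (\dim Y - \dim U)%N -> (W + U = Y)%VS.
Proof.
move=> sUY sWY dWU dimW; apply/eqP.
rewrite eqEdim subv_add sWY sUY dimv_disjoint_sum // dimW.
by rewrite subnK // dimvS.
Qed.

(* Induction on the codimension of [J + U] in [Y]: both sides of the recursion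
   count the pairs [(w, W)] where [w \in W] lies outside [J]. *)
Lemma card_compl_between Y U J :
  (U <= Y)%VS -> (J <= Y)%VS -> (J :&: U = 0)%VS ->
  #|[set W : {vspace V} | [&& (J <= W)%VS, (W <= Y)%VS, (W :&: U == 0)%VS
       & \dim W == (\dim Y - \dim U)%N]]|
  = (q ^ (\dim U * (\dim Y - \dim U - \dim J)))%N.
Proof.
move=> sUY; have [k] := ubnP (\dim Y - \dim U - \dim J)%N.
elim: k => // k IHk in J *; rewrite ltnS => lek sJY dJU.
have dimJU : \dim (J + U) = (\dim J + \dim U)%N by rewrite dimv_disjoint_sum.
have sJUY : (J + U <= Y)%VS by rewrite subv_add sJY.
have leJUY : (\dim J + \dim U <= \dim Y)%N by rewrite -dimJU dimvS.
set SW := [set W : {vspace V} | _].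
have [k0 | kpos] := posnP (\dim Y - \dim U - \dim J)%N.
  rewrite k0 muln0; suff -> : SW = [set J] by rewrite cards1.
  apply/setP=> W; rewrite !inE; apply/and4P/eqP => [[sJW _ _ /eqP dW]|->].
    by apply/esym/eqP; rewrite eqEdim sJW dW; lia.
  by rewrite subvv sJY dJU eqxx; split=> //; lia.
have pairs : (\sum_(w in [set w in Y | w \notin (J + U)%VS])
     #|[set W in SW | w \in W]| = \sum_(W in SW) #|[set w in W | w \notin J]|)%N.
  under eq_bigr do rewrite -sum1_card.
  under [RHS]eq_bigr do rewrite -sum1_card.
  rewrite (exchange_big_dep (mem SW)) /=; last by move=> w W _; rewrite !inE => /andP[].
  apply: eq_bigr => W; rewrite inE => /and4P[sJW sWY dWU dW].
  apply: eq_bigl => w; rewrite !inE sJW sWY dWU dW /=.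
  have [wW|_] := boolP (w \in W); rewrite ?andbF ?andbT // (subvP sWY) //=.
  apply/idP/idP; first by apply: contra; apply/subvP/addvSl.
  apply: contra => /memv_addP[j jJ [u uU wE]].
  suff: u \in (W :&: U)%VS by rewrite (eqP dWU) memv0 => /eqP u0; rewrite wE u0 addr0.
  rewrite memv_cap uU andbT -[u](addKr j) -wE addrC memvB //.
  by apply: (subvP sJW).
(* As [w] lies outside [J + U], the space [J + <[w]>] still meets [U] trivially, and the [W] counted
   are those containing it, so the induction hypothesis applies. *)
have LHS w : w \in [set w in Y | w \notin (J + U)%VS] ->
    #|[set W in SW | w \in W]| = (q ^ (\dim U * (\dim Y - \dim U - \dim J).-1))%N.
  rewrite inE => /andP[wY wJU].
  have wJ : w \notin J by apply: contra wJU; apply/subvP/addvSl.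
  have dJw := dim_addv_line wJ.
  have -> : (\dim Y - \dim U - \dim J).-1 =
            (\dim Y - \dim U - \dim (J + <[w]>))%N by rewrite dJw; lia.
  rewrite -IHk ?dJw; first last.
  - apply/eqP; rewrite -dimv_eq0; have := dimv_sum_cap (J + <[w]>) U.
    rewrite -addvA [(<[w]> + U)%VS]addvC addvA dim_addv_line // dimJU dJw.
    by lia.
  - by rewrite subv_add sJY -memvE.
  - by lia.
  apply: eq_card => W; rewrite !inE subv_add -memvE.
  by case: (w \in W); rewrite ?andbT ?andbF.
have RHS W : W \in SW ->
    #|[set w in W | w \notin J]| = (q ^ (\dim Y - \dim U) - q ^ \dim J)%N.
  by rewrite inE => /and4P[sJW _ _ /eqP dW]; rewrite card_vspaceD // dW.
move: pairs; rewrite (eq_bigr _ LHS) (eq_bigr _ RHS) !sum_nat_const.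
rewrite card_vspaceD // dimJU => E.
have q1 : (1 < q)%N by apply: finNzRing_gt1.
have pos : (0 < q ^ (\dim Y - \dim U) - q ^ \dim J)%N.
  by rewrite subn_gt0 ltn_exp2l //; lia.
apply/eqP; rewrite -(eqn_pmul2r pos) -E.
have -> : (q ^ \dim Y - q ^ (\dim J + \dim U) =
           q ^ \dim U * (q ^ (\dim Y - \dim U) - q ^ \dim J))%N.
  by rewrite mulnBr -!expnD; congr (_ ^ _ - _ ^ _)%N; lia.
rewrite mulnAC -expnD -mulnS prednK //.
Qed.

(** Each [w] of [Y] outside [X] lies in exactly one such [W], namely [X + <[w]>]; counting the pairs
    [(w, W)] twice gives a Gaussian integer. *)
Lemma card_succ_between X Y : (X <= Y)%VS ->
  #|[set W : {vspace V} | [&& (X <= W)%VS, (W <= Y)%VS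
      & \dim W == (\dim X).+1]]|
  = (\sum_(i < \dim Y - \dim X) q ^ i)%N.
Proof.
move=> sXY; set SW := [set W : {vspace V} | _].
have q1 : (1 < q)%N by apply: finNzRing_gt1.
have pairs : (\sum_(w in [set w in Y | w \notin X])
     #|[set W in SW | w \in W]| = \sum_(W in SW) #|[set w in W | w \notin X]|)%N.
  under eq_bigr do rewrite -sum1_card.
  under [RHS]eq_bigr do rewrite -sum1_card.
  rewrite (exchange_big_dep (mem SW)) /=; last by move=> w W _; rewrite !inE => /andP[].
  apply: eq_bigr => W; rewrite inE => /and3P[sXW sWY dW].
  apply: eq_bigl => w; rewrite !inE sXW sWY dW /=.
  by have [wW|_] := boolP (w \in W); rewrite ?andbF ?andbT // (subvP sWY).
have LHS w : w \in [set w in Y | w \notin X] -> #|[set W in SW | w \in W]| = 1%N.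
  rewrite inE => /andP[wY wX]; apply/eqP/cards1P; exists (X + <[w]>)%VS.
  apply/setP=> W; rewrite !inE; apply/andP/eqP => [[/and3P[sXW _ /eqP dW] wW]|->].
    by apply/esym/eqP; rewrite eqEdim subv_add sXW -memvE wW dim_addv_line // dW /=.
  rewrite addvSl dim_addv_line // eqxx andbT subv_add sXY -memvE wY.
  by split=> //; rewrite memvE addvSr.
have RHS W : W \in SW ->
    #|[set w in W | w \notin X]| = (q ^ (\dim X).+1 - q ^ \dim X)%N.
  by rewrite inE => /and3P[sXW _ /eqP dW]; rewrite card_vspaceD // dW.
move: pairs; rewrite (eq_bigr _ LHS) (eq_bigr _ RHS) !sum_nat_const.
rewrite card_vspaceD // muln1 => E.
have pos : (0 < q ^ (\dim X).+1 - q ^ \dim X)%N by rewrite subn_gt0 ltn_exp2l.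
apply/eqP; rewrite -(eqn_pmul2r pos) -E.
have -> : (q ^ (\dim X).+1 - q ^ \dim X = q ^ \dim X * q.-1)%N.
  by rewrite expnS -{2}[(q ^ _)%N]mul1n -mulnBl subn1 mulnC.
rewrite mulnC -mulnA -predn_exp -subn1 mulnBr muln1 -expnD.
by rewrite subnKC // dimvS.
Qed.

End SubspaceCounting.

Lemma dimv_rVf (F : fieldType) m : \dim {: 'rV[F]_m} = m.
Proof. by rewrite dimvf dim_matrix mul1r. Qed.

(** * Möbius inversion on the subspace lattice *)

Section InclusionExclusion.

Variables (R : comNzRingType) (F : finFieldType).
Local Notation q := #|F|.

(** The Möbius function of the subspace lattice on an interval of length [d]. *)
Definition subspace_mobius (d : nat) : R := (-1) ^+ d * (q ^ 'C(d, 2))%:R.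

Lemma subspace_mobiusS d :
  subspace_mobius d.+1 = - (q ^ d)%:R * subspace_mobius d.
Proof.
rewrite /subspace_mobius binS bin1 addnC expnD natrM exprS.
by rewrite mulN1r !mulNr mulrCA.
Qed.

(* Summing over the subspaces through a point [P] and over their complements
   of [P] separately, the terms attached to each [J] containing [P] cancel. *)
Lemma sum_subspace_mobius m (X : {vspace 'rV[F]_m}) :
  \sum_(I : {vspace 'rV[F]_m} | (I <= X)%VS) subspace_mobius (\dim I)
  = (X == 0%VS)%:R.
Proof.
have [->|X0] := eqVneq X 0%VS.
  rewrite (big_pred1 0%VS) => [|I]; last by rewrite subv0.
  by rewrite dimv0 /subspace_mobius bin0n mulr1.
set w := vpick X; have wX : w \in X by apply: memv_pick.
have w0 : w != 0 by rewrite vpick0.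
rewrite (bigID (fun I : {vspace 'rV[F]_m} => w \in I)) /=.
rewrite [X in _ + X](partition_big (fun I : {vspace 'rV[F]_m} => (I + <[w]>)%VS)
   (fun J => (J <= X)%VS && (w \in J))) /=; last first.
  by move=> I /andP[sIX _]; rewrite subv_add sIX -memvE wX memvE addvSr.
rewrite -big_split big1 //= => J /andP[sJX wJ].
have dimJ : (0 < \dim J)%N.
  by rewrite lt0n dimv_eq0; apply: contraNneq w0 => J0; rewrite J0 memv0 in wJ.
have sPJ : (<[w]> <= J)%VS by rewrite -memvE.
rewrite (eq_bigr (fun=> subspace_mobius (\dim J).-1)); last first.
  by move=> I /andP[/andP[_ wI] /eqP <-]; rewrite dim_addv_line.
(* The [I] avoiding [w] with [I + <[w]> = J] are the complements of [<[w]>] in [J]; their number is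
   the factor in [subspace_mobiusS]. *)
set S := [set I : {vspace 'rV[F]_m} | [&& (0 <= I)%VS, (I <= J)%VS,
  (I :&: <[w]> == 0)%VS & \dim I == (\dim J - \dim <[w]>)%N]].
rewrite (eq_bigl (mem S)) => [|I].
  rewrite sumr_const /S card_compl_between ?sub0v ?cap0v // dim_vline w0 dimv0.
  rewrite subn0 mul1n subn1 -{1}(prednK dimJ) subspace_mobiusS mulNr.
  by rewrite mulr_natl addNr.
rewrite !inE sub0v /= dim_vline w0 subn1.
apply/andP/and3P => [[/andP[sIX wI] /eqP defJ]|[sIJ /eqP dIw /eqP dimI]].
  have dimJI : \dim J = (\dim I).+1 by rewrite -defJ dim_addv_line.
  rewrite dimJI eqxx -defJ addvSl; split=> //; rewrite -dimv_eq0.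
  have := dimv_sum_cap I <[w]>; rewrite dim_vline w0 defJ dimJI; lia.
rewrite (subv_trans sIJ sJX) (@compl_addv _ _ J) ?dim_vline ?w0 ?subn1 ?eqxx //.
split=> //; apply: contra w0 => wI.
by rewrite -memv0 -dIw memv_cap wI memv_line.
Qed.

End InclusionExclusion.

(** * The complement operator and the filtration by dimension *)

Section Kneser.

Variables (R : comNzRingType) (F : finFieldType) (n : nat).
Local Notation q := #|F|.
Local Notation V := 'rV[F]_(2 * n).
Implicit Types (U W I L : {vspace V}) (f g : {vspace V} -> R).

Definition kneser g U : R :=
  \sum_(W : {vspace V} | (\dim W == n) && (W :&: U == 0)%VS) g W.

(** The bound is strict, so [k = 0] gives the zero function and a descent can end there. *)
Definition lower_sum k f U : R :=
  \sum_(I : {vspace V} | (I <= U)%VS && (\dim I < k)%N) f I.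

Definition kneser_coef k f L : R :=
  subspace_mobius R F (\dim L) *
  \sum_(I : {vspace V} | (L <= I)%VS && (\dim I < k)%N)
    (q ^ (n * (n - \dim I)))%:R * f I.

(* Only the [I] with [I :&: U = 0] survive in the double sum, and the Möbius
   identity on [I :&: U] turns this condition into a sum over [L <= I :&: U]. *)
Lemma kneser_lower_sum k f U : \dim U = n ->
  kneser (lower_sum k f) U = lower_sum k (kneser_coef k f) U.
Proof.
move=> dimU; have dimV : \dim {:V} = (2 * n)%N by apply: dimv_rVf.
rewrite /kneser /lower_sum.
rewrite (exchange_big_dep (fun I : {vspace V} => \dim I < k)%N) /=; last first.
  by move=> W I _ /andP[].
transitivity (\sum_(I : {vspace V} | (\dim I < k)%N)
   (q ^ (n * (n - \dim I)))%:R * f I *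
   \sum_(L : {vspace V} | (L <= I :&: U)%VS) subspace_mobius R F (\dim L)).
  apply: eq_bigr => I ltIk; rewrite sum_subspace_mobius.
  pose S := [set W : {vspace V} | [&& (I <= W)%VS, (W <= fullv)%VS,
    (W :&: U == 0)%VS & \dim W == (\dim {:V} - \dim U)%N]].
  have dimVU : (\dim {:V} - \dim U)%N = n by rewrite dimV dimU; lia.
  rewrite (eq_bigl (mem S)) => [|W].
    rewrite sumr_const; case: eqP => [dIU|/eqP dIU]; rewrite ?mulr1 ?mulr0.
      by rewrite /S card_compl_between ?subvf // dimVU dimU mulr_natl.
    rewrite (_ : S = set0) ?cards0 //; apply/setP=> W; rewrite !inE.
    apply: contraNF dIU => /and4P[sIW _ /eqP dWU _].
    by rewrite -subv0 -dWU capvS.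
  by rewrite !inE subvf dimVU ltIk andbT andbC [(\dim W == n) && _]andbC.
under [LHS]eq_bigr do rewrite mulr_sumr.
rewrite (exchange_big_dep (fun L : {vspace V} => (L <= U)%VS && (\dim L < k)%N)) /=.
  apply: eq_bigr => L /andP[sLU ltLk]; rewrite /kneser_coef mulr_sumr.
  under [RHS]eq_bigr do rewrite mulrC.
  by apply: eq_bigl => I; rewrite subv_cap sLU andbT andbC.
move=> I L ltIk; rewrite subv_cap => /andP[sLI ->] /=.
by apply: leq_ltn_trans ltIk; apply: dimvS.
Qed.

Definition kneser_eigenvalue j : R :=
  (q ^ (n * (n - j)))%:R * subspace_mobius R F j.

(** Only [I = L] survives the dimension bound: the operator is triangular for the filtration, with
    this diagonal entry. *)
Lemma kneser_coef_top k f L : \dim L = k ->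
  kneser_coef k.+1 f L = kneser_eigenvalue k * f L.
Proof.
move=> dimL; rewrite /kneser_coef (big_pred1 L) => [|I].
  by rewrite dimL mulrCA mulrA.
apply/andP/eqP => [[sLI leI]|->]; last by rewrite subvv dimL.
by apply/esym/eqP; rewrite eqEdim sLI dimL -ltnS.
Qed.

(** The terms of dimension [k] cancel by [kneser_coef_top], so subtracting the diagonal scalar
    lowers the filtration by one. *)
Lemma kneser_lower_sum_sub k f U : \dim U = n ->
  kneser (lower_sum k.+1 f) U - kneser_eigenvalue k * lower_sum k.+1 f U
  = lower_sum k (fun L => kneser_coef k.+1 f L - kneser_eigenvalue k * f L) U.
Proof.
move=> dimU; rewrite kneser_lower_sum // /lower_sum mulr_sumr -sumrB.
rewrite (bigID (fun L : {vspace V} => \dim L < k)%N) /= addrC big1 ?add0r.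
  by apply: eq_bigl => L; rewrite -andbA; congr (_ && _); apply/andb_idl => /leqW.
move=> L /andP[/andP[_ leLk]]; rewrite -leqNgt => leLk'.
by rewrite kneser_coef_top ?subrr //; apply/eqP; rewrite eqn_leq leLk' -ltnS leLk.
Qed.

(** Start of the descent: an [n]-subspace contains no other, so coefficients supported in dimension
    [n] represent any function. *)
Lemma lower_sum_full g U : \dim U = n ->
  lower_sum n.+1 (fun I => if \dim I == n then g I else 0) U = g U.
Proof.
move=> dimU; rewrite /lower_sum -big_mkcondr (big_pred1 U) => [//|I].
apply/andP/eqP => [[/andP[sIU _] /eqP dimI]|->]; last by rewrite subvv dimU ltnSn.
by apply/eqP; rewrite eqEdim sIU dimU dimI /=.
Qed.

End Kneser.

(** * The least diagonal scalar and the descent through the layers *)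

Section KneserSpectrum.

Variables (R : realFieldType) (F : finFieldType) (n : nat).
Local Notation q := #|F|.
Local Notation V := 'rV[F]_(2 * n).
Local Notation theta := (kneser_eigenvalue R F n).

(** For even [j] the sign is positive; for odd [j >= 3] the bound ['C(j, 2) < n * (j - 1)] makes the
    absolute value smaller. *)
Lemma kneser_eigenvalue1_lt j : (0 < n)%N -> (j <= n)%N -> j != 1%N ->
  theta 1 < theta j.
Proof.
move=> n0 lejn j1; have q1 : (1 < q)%N by apply: finNzRing_gt1.
rewrite /kneser_eigenvalue /subspace_mobius bin_small // expr1 mulr1 mulrN1.
have [jodd|jeven] := boolP (odd j); rewrite -signr_odd.
  rewrite jodd expr1 mulN1r mulrN ltrN2 -natrM ltr_nat -expnD ltn_exp2l //.
  have : ('C(j, 2) * 2 = j * j.-1)%N by rewrite mulnC -mul_bin_diag bin1.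
  by move: j1 jodd; case: j lejn => [|[|j]] //=; nia.
rewrite (negbTE jeven) expr0 mul1r -natrM.
apply: (@lt_le_trans _ _ 0); last exact: ler0n.
by rewrite oppr_lt0 ltr0n expn_gt0 ltnW.
Qed.

(* Applying [K - lambda] to [g] lies one layer lower as long as [lambda] is not
   the eigenvalue of the top layer. *)
Lemma kneser_eigenvector_lower_sum (lambda : R) k d (g : {vspace V} -> R) :
  (forall j, (k <= j < k + d)%N -> lambda != theta j) ->
  (forall U, \dim U = n -> kneser g U = lambda * g U) ->
  (exists f, forall U : {vspace V}, \dim U = n -> g U = lower_sum (k + d) f U) ->
  exists f, forall U : {vspace V}, \dim U = n -> g U = lower_sum k f U.
Proof.
move=> neq Kg; elim: d neq => [|d IHd] neq [f gE]; first by exists f; rewrite -(addn0 k).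
apply: IHd => [j /andP[lekj ltj]|].
  by apply: neq; rewrite lekj addnS ltnW.
have ne : lambda - theta (k + d) != 0 by rewrite subr_eq0 neq // leq_addr addnS ltnSn.
(* These are the coefficients of [(lambda - theta)^-1 (K - theta) g], which is [g] itself because
   [K g = lambda g]. *)
exists (fun L => (lambda - theta (k + d))^-1 *
  (kneser_coef (k + d).+1 f L - theta (k + d) * f L)) => U dimU.
rewrite /lower_sum -mulr_sumr -/(lower_sum (k + d) _ U) -kneser_lower_sum_sub //.
have -> : kneser (lower_sum (k + d).+1 f) U = kneser g U.
  by apply: eq_bigr => W /andP[/eqP dW _]; rewrite gE // addnS.
by rewrite Kg // -addnS -gE // -mulrBl mulrA mulVf // mul1r.
Qed.

End KneserSpectrum.

(** * Counting walks with prescribed branching numbers *)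

Section StepCounting.

Variable T : finType.
Implicit Types (r : nat -> rel T) (x y : T).

(** The relation depends on the position because the condition on a member of a flag depends on its
    dimension. *)
Fixpoint steps r i x (s : seq T) : bool :=
  if s is y :: s' then r i x y && steps r i.+1 y s' else true.

Lemma stepsP r i x s x0 :
  reflect (forall j, (j < size s)%N -> r (i + j)%N (nth x0 (x :: s) j) (nth x0 s j))
          (steps r i x s).
Proof.
elim: s i x => [|y s IHs] i x /=; first by apply: ReflectT.
apply: (iffP andP) => [[rxy /IHs rs] [|j] ltj | rs].
- by rewrite addn0.
- by rewrite addnS -addSn; apply: rs.
split; first by have := rs 0 isT; rewrite addn0.
by apply/IHs => j ltj; rewrite addSn -addnS; apply: (rs j.+1).
Qed.

Lemma card_stepsS r i x k :
  #|[set s : k.+1.-tuple T | steps r i x s]|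
  = (\sum_(y | r i x y) #|[set s : k.-tuple T | steps r i.+1 y s]|)%N.
Proof.
rewrite -sum1dep_card (reindex (fun p : T * k.-tuple T => [tuple of p.1 :: p.2])) /=.
  rewrite -(pair_big_dep (r i x) (fun y (s : k.-tuple T) => steps r i.+1 y s)
              (fun _ _ => 1%N)) /=.
  by apply: eq_bigr => y _; rewrite sum1dep_card.
exists (fun t : k.+1.-tuple T => (thead t, [tuple of behead t])) => [[y s] _|t _] /=.
  by congr pair; apply: val_inj.
by rewrite [RHS]tuple_eta; apply: val_inj.
Qed.

(** The walks form a tree; [P] is an invariant ensuring that each vertex at depth [i] has [N i]
    children. *)
Lemma card_steps r (P : nat -> T -> Prop) (N : nat -> nat) K :
  (forall i x, (i < K)%N -> P i x -> #|[set y | r i x y]| = N i) ->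
  (forall i x y, (i < K)%N -> P i x -> r i x y -> P i.+1 y) ->
  forall k i x, (i + k <= K)%N -> P i x ->
  #|[set s : k.-tuple T | steps r i x s]| = (\prod_(i <= j < i + k) N j)%N.
Proof.
move=> cardN stepP; elim=> [|k IHk] i x leK Pix.
  rewrite addn0 big_geq //; apply/eqP/cards1P; exists [tuple].
  by apply/setP=> s; rewrite !inE tuple0 /= eqxx.
have ltK : (i < K)%N by lia.
rewrite card_stepsS addnS big_ltn ?leq_addr // -addSn.
rewrite (eq_bigr (fun=> \prod_(i.+1 <= j < i.+1 + k) N j)%N) => [|y rxy].
  by rewrite -(cardN i x) // sum_nat_cond_const; congr (_ * _)%N.
by apply: IHk; [lia | apply: stepP rxy].
Qed.

End StepCounting.

(** * Chambers as walks *)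

Section ChamberCounting.

Variables (F : finFieldType) (m : nat).
Local Notation q := #|F|.
Local Notation V := 'rV[F]_m.
Implicit Types (C D : chamber F m) (U X Y : {vspace V}).

Definition flag_step (P : nat -> pred {vspace V}) i X Y : bool :=
  [&& (X <= Y)%VS, \dim Y == i.+1 & P i.+1 Y].

Lemma dim_chamber_nth C i : (0 < i < m)%N -> \dim (chamber_nth C i) = i.
Proof.
case: C => s sP /andP[i0 im]; have /andP[_ /eqP ds] := sP; rewrite /chamber_nth /=.
have lti : (i.-1 < m.-1)%N by lia.
rewrite -(nth_map _ 0%N) ?size_tuple // ds nth_iota //; lia.
Qed.

Lemma chamber_nthS C i : (i.+1 < m)%N -> (chamber_nth C i <= chamber_nth C i.+1)%VS.
Proof.
case: C => s sP im; have /andP[ss _] := sP; rewrite /chamber_nth /=.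
(* [chamber_nth C 0] is [C_1], since [0.-1] is [0]; the inclusion is then reflexive. *)
case: i im => [|i] im /=; first exact: subvv.
by move/(sortedP 0%VS): ss; apply; rewrite size_tuple; lia.
Qed.

Lemma chamber_nth_le C i j : (i <= j < m)%N -> (chamber_nth C i <= chamber_nth C j)%VS.
Proof.
case/andP; elim: j => [|j IHj]; first by rewrite leqn0 => /eqP->.
rewrite leq_eqVlt ltnS => /orP[/eqP-> // |leij] jm.
exact: subv_trans (IHj leij (ltnW jm)) (chamber_nthS _ jm).
Qed.

(** A chamber is a walk from the zero subspace that gains one dimension per step; the zero subspace
    itself is not listed. *)
Lemma card_chambers_steps (P : nat -> pred {vspace V}) :
  #|[set C : chamber F m | [forall i : 'I_m, (0 < i)%N ==> P i (chamber_nth C i)]]|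
  = #|[set s : (m.-1).-tuple {vspace V} | steps (flag_step P) 0 0%VS s]|.
Proof.
rewrite -(card_imset _ val_inj); apply: eq_card => s; rewrite [RHS]inE.
apply/imsetP/idP => [[C]|/(stepsP _ _ _ _ 0%VS) st].
  rewrite inE => /forallP PC ->; apply/(stepsP _ _ _ _ 0%VS) => j.
  rewrite size_tuple add0n => ltj; have ltjm : (j.+1 < m)%N by lia.
  have := PC (Ordinal ltjm); rewrite /= /flag_step => PCj.
  rewrite -[nth 0%VS (val C) j]/(chamber_nth C j.+1) dim_chamber_nth // eqxx PCj !andbT.
  case: j {ltj PCj} ltjm => [|j] ltjm; first exact: (sub0v (chamber_nth C 1)).
  by have := chamber_nthS C ltjm; rewrite {1}/chamber_nth /=.
have sz := size_tuple s; rewrite sz in st.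
have sP : is_chamber s.
  apply/andP; split.
    apply/(sortedP 0%VS) => i; rewrite sz => lti.
    by have /and3P[] := st i.+1 lti.
  apply/eqP/(@eq_from_nth _ 0%N); first by rewrite size_map size_iota sz.
  move=> i; rewrite size_map sz => lti; rewrite (nth_map 0%VS) ?sz // nth_iota //.
  by have /and3P[_ /eqP ->] := st i lti.
exists (Sub s sP); last by rewrite SubK.
rewrite inE; apply/forallP => i; apply/implyP => i0.
have lti : (i.-1 < m.-1)%N by have := ltn_ord i; lia.
have /and3P[_ _] := st i.-1 lti; rewrite /chamber_nth SubK.
by rewrite add0n prednK.
Qed.

(** The factors are [(q^(m-i) - 1)/(q - 1)]; the one for [i = m - 1], which is [1], is left out. *)
Lemma num_chambersE :
  num_chambers F m = (\prod_(0 <= i < m.-1) \sum_(j < m - i) q ^ j)%N.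
Proof.
transitivity #|[set C : chamber F m | [forall i : 'I_m, (0 < i)%N ==> true]]|.
  rewrite /num_chambers -cardsT; apply: eq_card => C; rewrite !inE.
  by apply/esym/forallP => i; rewrite implybT.
rewrite (card_chambers_steps (fun _ _ => true)).
rewrite (@card_steps _ _ (fun i X => \dim X = i)
  (fun i => \sum_(j < m - i) q ^ j)%N m.-1) //.
- move=> i X _ dimX; have dimV : \dim {:V} = m by apply: dimv_rVf.
  have := card_succ_between (subvf X); rewrite dimX dimV => <-.
  by apply: eq_card => Y; rewrite !inE /flag_step subvf andbT.
- by move=> i X Y _ _ /and3P[_ /eqP].
- exact: dimv0.
Qed.

Lemma opposite_sym : symmetric (@opposite F m).
Proof.
suff opp C D : opposite C D -> opposite D C by move=> C D; apply/idP/idP; apply: opp.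
move=> /forallP CD; apply/forallP => i; apply/implyP => i0.
have ltm : (m - i < m)%N by have := ltn_ord i; lia.
have /implyP := CD (Ordinal ltm); rewrite /= subKn ?(ltnW (ltn_ord i)) // capvC.
by apply; rewrite subn_gt0.
Qed.

End ChamberCounting.

(** * Chambers with a given middle subspace *)

Section MiddleSubspace.

Variables (F : finFieldType) (n : nat).
Hypothesis n_gt0 : (0 < n)%N.
Local Notation q := #|F|.
Local Notation V := 'rV[F]_(2 * n).
Implicit Types (C D : chamber F (2 * n)) (U X Y : {vspace V}).

Lemma dim_chamber_mid C : \dim (chamber_nth C n) = n.
Proof. by apply: dim_chamber_nth; lia. Qed.

(** This splits the condition on [C_n] into conditions on single members, the form that
    [card_chambers_steps] takes. *)
Lemma chamber_midP C U : \dim U = n ->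
  (chamber_nth C n == U) =
  [forall i : 'I_(2 * n), (0 < i)%N ==> (i <= n)%N ==> (chamber_nth C i <= U)%VS].
Proof.
move=> dimU; have ltn : (n < 2 * n)%N by lia.
apply/eqP/forallP => [<- i | /(_ (Ordinal ltn))].
  by do 2!apply/implyP => ?; apply: chamber_nth_le; lia.
rewrite /= n_gt0 leqnn /= => sCU; apply/eqP.
by rewrite eqEdim sCU dim_chamber_mid dimU /=.
Qed.

Lemma card_chambers_mid U : \dim U = n ->
  #|[set C : chamber F (2 * n) | chamber_nth C n == U]| = (num_chambers F n ^ 2)%N.
Proof.
(* Up to dimension [n] the flag grows inside [U], afterwards inside the whole space. *)
move=> dimU; pose N i := (\sum_(j < (if i < n then n else 2 * n) - i) q ^ j)%N.
pose P i X := \dim X = i /\ ((i <= n)%N -> (X <= U)%VS).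
have dimV : \dim {:V} = (2 * n)%N by apply: dimv_rVf.
transitivity (\prod_(0 <= i < 0 + (2 * n).-1) N i)%N.
  pose E i X := (i <= n)%N ==> (X <= U)%VS.
  rewrite -(@card_steps _ (flag_step E) P _ (2 * n).-1 _ _ _ _ 0%VS) //; last 2 first.
  - by move=> i X Y lti [_ _] /and3P[_ /eqP dY /implyP sYU].
  - by split=> [|_]; rewrite ?dimv0 ?sub0v.
  - rewrite -card_chambers_steps; apply: eq_card => C; rewrite !inE.
    exact: chamber_midP.
  move=> i X lti [dimX sXU]; rewrite /N; case: ltnP => leni.
    have := card_succ_between (sXU (ltnW leni)); rewrite dimU dimX => <-.
    by apply: eq_card => Y; rewrite !inE /flag_step /E leni /= [(_ == _) && _]andbC.
  have := card_succ_between (subvf X); rewrite dimX dimV => <-.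
  by apply: eq_card => Y; rewrite !inE /flag_step /E subvf /= ltnNge leni andbT.
have E1 : (\prod_(0 <= i < n.-1) N i)%N = num_chambers F n.
  rewrite num_chambersE; apply: eq_big_nat => i /andP[_ lti].
  by rewrite /N ifT //; lia.
have nn1 : (n - n.-1 = 1)%N by lia.
(* The step into dimension [n] is forced: it ends at [U]. *)
have E2 : N n.-1 = 1%N by rewrite /N ltn_predL n_gt0 nn1 big_ord1.
(* Shifted by [n], these factors count the flags of the quotient by [U]. *)
have E3 : (\prod_(n <= i < (2 * n).-1) N i)%N = num_chambers F n.
  rewrite num_chambersE -{1}[n]add0n big_addn (_ : (2 * n).-1 - n = n.-1)%N; last by lia.
  apply: eq_big_nat => i /andP[_ lti]; rewrite /N ifF; last by lia.
  by rewrite (_ : 2 * n - (i + n) = n - i)%N //; lia.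
rewrite add0n (@big_cat_nat _ _ _ n) /=; [|lia|lia].
rewrite -{1}(prednK n_gt0) big_nat_recr //= E1 E2 E3 muln1 mulnn //.
Qed.

(** The chamber is built member by member: [C_(i+1)] contains [C_i] and is a complement of the trace
    of [D_(2n-i-1)] on [U] (below the middle) or on the whole space, so the number of choices
    depends on [i] only. *)
Lemma card_opposite_mid : exists2 c, (0 < c)%N & forall D U, \dim U = n ->
  #|[set C : chamber F (2 * n) | (chamber_nth C n == U) && opposite C D]|
  = if (U :&: chamber_nth D n == 0)%VS then c else 0%N.
Proof.
pose N i := (q ^ ((if i < n then n else 2 * n) - i.+1))%N.
have q_gt0 : (0 < q)%N by apply/ltnW/finNzRing_gt1.
exists (\prod_(0 <= i < 0 + (2 * n).-1) N i)%N.
  by apply: prodn_gt0 => i; rewrite expn_gt0 q_gt0.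
move=> D U dimU; case: ifPn => [/eqP dUD | dUD]; last first.
  apply: eq_card0 => C; rewrite !inE; apply: contraNF dUD => /andP[/eqP <- /forallP CD].
  have ltn : (n < 2 * n)%N by lia.
  by have := CD (Ordinal ltn); rewrite /= n_gt0 (_ : 2 * n - n = n)%N //; lia.
pose E i X := ((i <= n)%N ==> (X <= U)%VS) && (X :&: chamber_nth D (2 * n - i) == 0)%VS.
(* The invariant involves the space that the next member has to avoid. For [i = 2n - 1] the index is
   [0], where [chamber_nth] returns [D_1]. *)
pose P i X := [/\ \dim X = i, (i <= n)%N -> (X <= U)%VS &
   (X :&: chamber_nth D (2 * n - i.+1) = 0)%VS].
have dimV : \dim {:V} = (2 * n)%N by apply: dimv_rVf.
rewrite -(@card_steps _ (flag_step E) P _ (2 * n).-1 _ _ _ _ 0%VS) //; last 2 first.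
- move=> i X Y lti _ /and3P[_ /eqP dY /andP[/implyP sYU /eqP dYD]]; split=> //.
  apply/eqP; rewrite -subv0 -dYD capvS ?subvv //; apply: chamber_nth_le; lia.
- by split=> [|_|]; rewrite ?dimv0 ?sub0v ?cap0v.
- rewrite -card_chambers_steps; apply: eq_card => C; rewrite !inE chamber_midP //.
  apply/andP/forallP => [[/forallP CU /forallP CD] i|CUD].
    by apply/implyP => i0; apply/andP; split; [move: (CU i)|move: (CD i)]; rewrite i0.
  split; apply/forallP => i; apply/implyP => i0; have := CUD i; rewrite i0 => /andP[] //.
move=> i X lti [dimX sXU dXD].
pose B := if (i < n)%N then U else {:V}%VS.
pose D' := (chamber_nth D (2 * n - i.+1) :&: B)%VS.
have dimB : \dim B = (if (i < n)%N then n else 2 * n)%N by rewrite /B; case: ifP.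
have dimD' : \dim D' = (\dim B - i.+1)%N.
  rewrite dimB /D' /B; case: ifPn => lei.
    (* [D_(2n-i-1)] contains [D_n], a complement of [U]; the dimension of its trace on [U]
       follows. *)
    have : (chamber_nth D (2 * n - i.+1) + U = fullv)%VS.
      apply/eqP; rewrite eqEsubv subvf /=.
      apply: (@subv_trans _ _ (chamber_nth D n + U)%VS).
        by rewrite (@compl_addv _ _ fullv) ?subvf ?dim_chamber_mid ?dimV 1?capvC //; lia.
      by rewrite addvS ?subvv //; apply: chamber_nth_le; lia.
    have := dimv_sum_cap (chamber_nth D (2 * n - i.+1)) U.
    by move=> + sumE; rewrite sumE dim_chamber_nth ?dimV ?dimU; lia.
  by rewrite capvf dim_chamber_nth //; lia.
have sXB : (X <= B)%VS by rewrite /B; case: ifP => [/ltnW/sXU|_]; rewrite ?subvf.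
have lein : (i.+1 <= \dim B)%N by rewrite dimB; case: ifP => //; lia.
have dXD' : (X :&: D' = 0)%VS.
  by apply/eqP; rewrite -subv0 -dXD capvS ?subvv ?capvSl.
have := card_compl_between (capvSr _ _) sXB dXD'.
rewrite -/D' dimD' dimX subKn // subSnn muln1 /N dimB => <-.
apply: eq_card => Y; rewrite !inE /flag_step /E /D'.
case: (X <= Y)%VS => //=; rewrite /B; case: ifPn => lei /=.
  case sYU: (Y <= U)%VS; rewrite /= ?andbF //.
  by rewrite andbC [(_ :&: U)%VS]capvC capvA (capv_idPl sYU).
by rewrite subvf capvf andbC.
Qed.

End MiddleSubspace.

(** * The layer generated by the points *)

Section Lines.

Variables (R : comNzRingType) (F : finFieldType) (n : nat).
Local Notation q := #|F|.
Local Notation V := 'rV[F]_(2 * n).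
Implicit Types (U W I L : {vspace V}) (f g : {vspace V} -> R).

Lemma sum_dim_lt2 (A : pred {vspace V}) f : A 0%VS ->
  \sum_(I | A I && (\dim I < 2)%N) f I = f 0%VS + \sum_(I | A I && (\dim I == 1%N)) f I.
Proof.
move=> A0; rewrite (bigD1 0%VS) ?A0 ?dimv0 //=; congr (_ + _).
apply: eq_bigl => I; rewrite -andbA; congr (_ && _).
by rewrite -dimv_eq0; case: (\dim I) => [|[|]].
Qed.

Lemma lower_sum1 f U : lower_sum 1 f U = f 0%VS.
Proof.
rewrite /lower_sum (big_pred1 0%VS) // => I.
by rewrite ltnS leqn0 dimv_eq0 /=; case: eqP => [->|_]; rewrite ?sub0v ?andbF.
Qed.

Lemma lower_sum2 f U :
  lower_sum 2 f U = f 0%VS + \sum_(I : {vspace V} | (I <= U)%VS && (\dim I == 1%N)) f I.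
Proof. by rewrite /lower_sum sum_dim_lt2 // sub0v. Qed.

(** Only the coefficient at the zero subspace remains, a constant in [U], which must vanish for an
    eigenvector for the scalar of layer [1]. *)
Lemma kneser_lower_sum2 f U : \dim U = n ->
  kneser (lower_sum 2 f) U - kneser_eigenvalue R F n 1 * lower_sum 2 f U
  = ((q ^ (n * n))%:R + (q ^ (n * (n - 1)))%:R) * f 0%VS
    + (q ^ (n * (n - 1)))%:R * \sum_(I : {vspace V} | \dim I == 1%N) f I.
Proof.
move=> dimU; rewrite kneser_lower_sum_sub // lower_sum1 /kneser_coef.
rewrite sum_dim_lt2 ?sub0v // dimv0 subn0 mulr_sumr.
rewrite (eq_bigl (fun I : {vspace V} => \dim I == 1%N)); last by move=> I; rewrite sub0v.
rewrite [in LHS](eq_bigr (fun I => (q ^ (n * (n - 1)))%:R * f I)); last first.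
  by move=> I /eqP->.
rewrite /kneser_eigenvalue /subspace_mobius !bin_small // expr0 expr1.
by ring.
Qed.

End Lines.

(** * The extremal eigenvectors and their sums over spreads *)

Section ExtremalEigenvalue.

Variables (R : realFieldType) (F : finFieldType) (n : nat).
Local Notation q := #|F|.
Local Notation V := 'rV[F]_(2 * n).
Implicit Types (U W I L : {vspace V}) (f g : {vspace V} -> R).

(** The coefficients are the difference of the indicators of a point in [U] and a point outside:
    their total is zero, so the constant in [kneser_lower_sum2] vanishes, while the value at [U] is
    [1]. *)
Lemma kneser_eigenvector1 U : (0 < n)%N -> \dim U = n ->
  exists2 g, g U != 0 & forall W, \dim W = n ->
    kneser g W = kneser_eigenvalue R F n 1 * g W.
Proof.
move=> n0 dimU; have dimV : \dim {:V} = (2 * n)%N by apply: dimv_rVf.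
have [w wU] : exists w, w \notin U.
  apply/existsP; rewrite -negb_forall; apply/negP => /forallP sU.
  suff : (\dim {:V} <= \dim U)%N by rewrite dimV dimU; lia.
  by apply/dimvS/subvP => v _; apply: sU.
set P := <[vpick U]>%VS; set Q := <[w]>%VS.
have dimP : \dim P = 1%N by rewrite dim_vline vpick0 -dimv_eq0 dimU; case: n n0.
have dimQ : \dim Q = 1%N by rewrite dim_vline; case: eqP wU => [->|]; rewrite ?mem0v.
have sPU : (P <= U)%VS by rewrite -memvE memv_pick.
have sQU : (Q <= U)%VS = false by rewrite -memvE; apply: negbTE.
pose f I : R := (I == P)%:R - (I == Q)%:R.
have sum_f (A : pred {vspace V}) :
    \sum_(I | A I && (\dim I == 1%N)) f I = (A P)%:R - (A Q)%:R.
  have sum_pt X : \dim X = 1%N ->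
      \sum_(I | A I && (\dim I == 1%N)) ((I == X)%:R : R) = (A X)%:R.
    move=> dimX; rewrite -natr_sum; congr _%:R.
    case AX: (A X); last first.
      by rewrite big1 // => I /andP[AI _]; case: eqP AI => [->|//]; rewrite AX.
    rewrite (bigD1 X) ?AX ?dimX //= eqxx big1 ?addn0 // => I /andP[_].
    by move/negbTE->.
  by rewrite sumrB !sum_pt.
have f0 : f 0%VS = 0.
  by rewrite /f !(eq_sym 0%VS) -!dimv_eq0 dimP dimQ subrr.
exists (lower_sum 2 f).
  by rewrite lower_sum2 f0 sum_f sPU sQU subr0 add0r oner_neq0.
move=> W dimW; apply/eqP; rewrite -subr_eq0 kneser_lower_sum2 // f0.
by rewrite (sum_f predT) /= subrr !mulr0 addr0.
Qed.

Section Spread.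

Variables (t : nat) (S : {set {vspace V}}).
Hypothesis (n_gt0 : (0 < n)%N) (S_spread : fold_spread t S).

(** Counting pairs of a nonzero vector and a member containing it gives
    [(q^(2n) - 1) t = #|S| (q^n - 1)]. *)
Lemma card_fold_spread : #|S| = (t * (q ^ n + 1))%N.
Proof.
have dimV : \dim {:V} = (2 * n)%N by apply: dimv_rVf.
have [dimS lineS] := S_spread; have q1 : (1 < q)%N by apply: finNzRing_gt1.
have pairs : (\sum_(v in [set v in {:V}%VS | v \notin 0%VS]) #|[set U in S | v \in U]|
    = \sum_(U in S) #|[set v in U | v \notin 0%VS]|)%N.
  under eq_bigr do rewrite -sum1_card.
  under [RHS]eq_bigr do rewrite -sum1_card.
  rewrite (exchange_big_dep (mem S)) /=; last by move=> v U _; rewrite !inE => /andP[].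
  apply: eq_bigr => U SU; apply: eq_bigl => v; rewrite !inE SU memvf /=.
  by rewrite andbC.
have LHS (v : V) : v \in [set v in {:V}%VS | v \notin 0%VS] ->
    #|[set U in S | v \in U]| = t.
  rewrite inE memvf memv0 /= => v0.
  by rewrite -(lineS <[v]>%VS) ?dim_vline ?v0.
have RHS U : U \in S -> #|[set v in U | v \notin 0%VS]| = (q ^ n - 1)%N.
  by move=> SU; rewrite card_vspaceD ?sub0v // dimS // dimv0.
move: pairs; rewrite (eq_bigr _ LHS) (eq_bigr _ RHS) !sum_nat_const.
rewrite card_vspaceD ?sub0v // dimV dimv0 expn0 => pairs.
have pos : (0 < q ^ n - 1)%N by rewrite subn_gt0 -(expn0 q) ltn_exp2l.
apply/eqP; rewrite -(eqn_pmul2r pos) -pairs -mulnA mulnC [(_ * (q ^ n - 1))%N]mulnC.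
by rewrite -subn_sqr -expnM exp1n [(n * 2)%N]mulnC.
Qed.

(** With [s] the sum of [f] over the points, the sum over [S] is [t ((q^n + 1) f 0 + s)], and the
    eigenvalue equation kills the bracket. *)
Lemma sum_spread_kneser_eigenvector1 g f :
  (forall U, \dim U = n -> g U = lower_sum 2 f U) ->
  (forall U, \dim U = n -> kneser g U = kneser_eigenvalue R F n 1 * g U) ->
  \sum_(U in S) g U = 0.
Proof.
move=> gE Kg; have [dimS lineS] := S_spread.
have q0 : (0 < q)%N by apply/ltnW/finNzRing_gt1.
have [->|[U0 SU0]] := set_0Vmem S; first by rewrite big_set0.
have dimU0 := dimS _ SU0.
have Kf : kneser (lower_sum 2 f) U0 = kneser g U0.
  by apply: eq_bigr => W /andP[/eqP dW _]; rewrite gE.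
have := kneser_lower_sum2 f dimU0; rewrite Kf -gE // Kg // subrr.
have -> : (n * n = n * (n - 1) + n)%N by nia.
rewrite expnD natrM -[X in _ + X]mulr1.
set x := (q ^ (n * (n - 1)))%:R; set y := (q ^ n)%:R; set s := \sum_(I | _) _ => /esym E.
have {}E : x * ((y + 1) * f 0%VS + s) = 0 by rewrite -E; ring.
have x0 : x != 0 by rewrite pnatr_eq0 -lt0n expn_gt0 q0.
move/eqP: E; rewrite mulf_eq0 (negbTE x0) /= => /eqP E.
rewrite (eq_bigr (fun U => f 0%VS +
   \sum_(I : {vspace V} | (I <= U)%VS && (\dim I == 1%N)) f I)); last first.
  by move=> U SU; rewrite gE ?dimS // lower_sum2.
rewrite big_split /= sumr_const.
rewrite (exchange_big_dep (fun I : {vspace V} => \dim I == 1%N)) /=; last first.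
  by move=> U I _ /andP[].
rewrite (eq_bigr (fun I => t%:R * f I)) => [|I /eqP dimI].
  transitivity (t%:R * ((y + 1) * f 0%VS + s)); last by rewrite E mulr0.
  rewrite -mulr_sumr card_fold_spread -[f 0%VS *+ _]mulr_natl natrM natrD.
  by rewrite -/y -/s; ring.
rewrite -(lineS I) // mulr_natl -sumr_const; apply: eq_bigl => U.
by rewrite !inE dimI eqxx andbT.
Qed.

End Spread.

End ExtremalEigenvalue.

(** * Eigenvectors as functions on vertices *)

Section Adjacency.

Variables (R : fieldType) (T : finType) (adj : rel T).

Lemma adjacency_eigenspaceP (a : R) (e : 'rV[R]_#|T|) :
  reflect (forall y, \sum_x e 0 (enum_rank x) * (adj x y)%:R = a * e 0 (enum_rank y))
          (e <= eigenspace (adjacency_mx R adj) a)%MS.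
Proof.
have mulE i : (e *m adjacency_mx R adj) 0 i
    = \sum_x e 0 (enum_rank x) * (adj x (enum_val i))%:R.
  rewrite mxE (reindex (@enum_rank T)); last first.
    by apply: onW_bij; apply: enum_rank_bij.
  by apply: eq_bigr => x _; rewrite mxE enum_rankK.
apply: (iffP eigenspaceP) => [eA y | eA].
  by have := mulE (enum_rank y); rewrite enum_rankK eA mxE => <-.
by apply/rowP => i; rewrite mulE eA mxE enum_valK.
Qed.

End Adjacency.

(** * Transfer between the opposition graph and the complement operator *)

Section Pushforward.

Variables (R : realFieldType) (F : finFieldType) (n c : nat).
Local Notation V := 'rV[F]_(2 * n).
Implicit Types (C D : chamber F (2 * n)) (U : {vspace V}).
Hypothesis n_gt0 : (0 < n)%N.
Hypothesis card_opp : forall D U, \dim U = n ->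
  #|[set C : chamber F (2 * n) | (chamber_nth C n == U) && opposite C D]|
  = if (U :&: chamber_nth D n == 0)%VS then c else 0%N.

Definition mid_sum (e : chamber F (2 * n) -> R) U : R :=
  \sum_(C | chamber_nth C n == U) e C.

(** Summing the eigenvalue equation over all [D] with middle [U], each [e C] is counted [c] times if
    [C_n] is a complement of [U], and never otherwise. *)
Lemma mid_sum_kneser (a : R) e :
  (forall D, \sum_C e C * (opposite C D)%:R = a * e D) ->
  forall U, \dim U = n -> c%:R * kneser (mid_sum e) U = a * mid_sum e U.
Proof.
move=> eA U dimU; rewrite /mid_sum [RHS]mulr_sumr; under [RHS]eq_bigr do rewrite -eA.
rewrite exchange_big /=.
have -> : kneser (mid_sum e) U = \sum_(C | (chamber_nth C n :&: U == 0)%VS) e C.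
  rewrite (partition_big (fun C => chamber_nth C n)
     (fun W => (\dim W == n) && (W :&: U == 0)%VS)) /=.
    apply: eq_bigr => W /andP[_ dWU]; apply: eq_bigl => C.
    by case: eqP => [->|]; rewrite ?andbF ?dWU.
  by move=> C ->; rewrite dim_chamber_mid ?eqxx.
rewrite mulr_sumr big_mkcond; apply: eq_bigr => C _; rewrite -mulr_sumr -natr_sum.
have -> : (\sum_(D | chamber_nth D n == U) opposite C D
   = if (U :&: chamber_nth C n == 0)%VS then c else 0)%N.
  rewrite -card_opp // -sum1dep_card big_mkcondr.
  by apply: eq_bigr => D _; rewrite opposite_sym; case: (opposite _ _).
by rewrite capvC; case: ifP => _; rewrite ?mulr0 // mulrC.
Qed.

(** Grouping the [C] by middle subspace shows that eigenvectors of the complement operator pull back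
    to the graph. *)
Lemma sum_opposite_mid (g : {vspace V} -> R) D :
  \sum_C g (chamber_nth C n) * (opposite C D)%:R = c%:R * kneser g (chamber_nth D n).
Proof.
rewrite (partition_big (fun C => chamber_nth C n) (fun W => \dim W == n)) /=; last first.
  by move=> C _; rewrite dim_chamber_mid.
rewrite /kneser mulr_sumr big_mkcondr; apply: eq_bigr => U /eqP dimU.
rewrite (eq_bigr (fun C => g U * (opposite C D)%:R)); last by move=> C /eqP->.
rewrite -mulr_sumr -natr_sum.
have -> : (\sum_(C | chamber_nth C n == U) opposite C D
   = if (U :&: chamber_nth D n == 0)%VS then c else 0)%N.
  rewrite -card_opp // -sum1dep_card big_mkcondr.
  by apply: eq_bigr => C _; case: (opposite _ _).
by case: ifP => _; rewrite ?mulr0 // mulrC.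
Qed.

End Pushforward.

Lemma num_chambers_gt0 (F : finFieldType) m : (0 < num_chambers F m)%N.
Proof.
rewrite num_chambersE big_nat_cond; apply: prodn_cond_gt0 => i /andP[/andP[_ lti] _].
have [k ->] : exists k, (m - i)%N = k.+1 by exists (m - i).-1; lia.
by rewrite big_ord_recl.
Qed.

(** * Spread vectors: weight and antidesign property *)

Section Main.

Variables (R : rcfType) (F : finFieldType) (n t : nat).
Local Notation V := 'rV[F]_(2 * n).
Variable S : {set {vspace V}}.
Hypotheses (n_gt0 : (0 < n)%N) (t_gt0 : (0 < t)%N) (S_spread : fold_spread t S).

Lemma sum_spread_vec :
  \sum_(C : chamber F (2 * n)) spread_vec S C
    = t%:R * (#|F|%:R ^+ n + 1) * (num_chambers F n)%:R ^+ 2.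
Proof.
have [dimS _] := S_spread.
rewrite /spread_vec -natr_sum -!natrX -[1]/(1%:R) -natrD -!natrM; congr _%:R.
rewrite -(card_fold_spread n_gt0 S_spread) -sum_nat_const.
transitivity (\sum_(C : chamber F (2 * n) | chamber_nth C n \in S) 1)%N.
  by rewrite [RHS]big_mkcond; apply: eq_bigr => C _; case: (_ \in _).
rewrite (partition_big (fun C => chamber_nth C n) (mem S)) //=.
apply: eq_bigr => U SU; rewrite -(card_chambers_mid n_gt0 (dimS U SU)) -sum1dep_card.
by apply: eq_bigl => C; case: eqP => [->|]; rewrite ?andbF ?SU.
Qed.

Lemma antidesign_spread_vec : antidesign R (spread_vec S).
Proof.
have [dimS _] := S_spread.
have [U0 SU0] : exists U0, U0 \in S.
  by apply/card_gt0P; rewrite (card_fold_spread n_gt0 S_spread) muln_gt0 t_gt0 addn1.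
have dimU0 := dimS U0 SU0.
have [c c_gt0 card_opp] := card_opposite_mid F n_gt0.
have cR : 0 < c%:R :> R by rewrite ltr0n.
move=> /= a e [_ a_min] /adjacency_eigenspaceP eA.
(* The pullback of [kneser_eigenvector1] shows that the right-hand side is an eigenvalue of the
   graph, so minimality of [a] applies. *)
have a_le : a <= c%:R * kneser_eigenvalue R F n 1.
  have [g gU0 Kg] := @kneser_eigenvector1 R F n U0 n_gt0 dimU0.
  apply: a_min; apply/eigenvalueP.
  exists (\row_i g (chamber_nth (enum_val i : chamber F (2 * n)) n)).
    apply/eigenspaceP/adjacency_eigenspaceP => D.
    under eq_bigr do rewrite mxE enum_rankK.
    rewrite (sum_opposite_mid n_gt0 card_opp) Kg ?dim_chamber_mid //.
    by rewrite mxE enum_rankK mulrA.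
  (* The pullback is nonzero because some chamber has middle [U0], where [g] does not vanish. *)
  have : (0 < #|[set C : chamber F (2 * n) | chamber_nth C n == U0]|)%N.
    by rewrite card_chambers_mid // expn_gt0 num_chambers_gt0.
  case/card_gt0P => C; rewrite inE => /eqP CU0.
  apply: contraNneq gU0 => /rowP/(_ (enum_rank C)).
  by rewrite !mxE enum_rankK CU0 => ->.
pose ebar := mid_sum (fun C : chamber F (2 * n) => e 0 (enum_rank C)).
pose lambda := a / c%:R.
have Kebar U : \dim U = n -> kneser ebar U = lambda * ebar U.
  move=> dimU; have := mid_sum_kneser n_gt0 card_opp eA dimU.
  move/(congr1 ( *%R c%:R^-1)); rewrite mulKf ?gt_eqF // => ->.
  by rewrite /lambda mulrA [_ * a]mulrC.
have lambda_le : lambda <= kneser_eigenvalue R F n 1.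
  by rewrite ler_pdivrMr // mulrC.
have lambda_ne j : (j < n.+1)%N -> j != 1%N -> lambda != kneser_eigenvalue R F n j.
  move=> lejn j1; rewrite lt_eqF //; apply: le_lt_trans lambda_le _.
  exact: kneser_eigenvalue1_lt.
have top : exists f, forall U : {vspace V}, \dim U = n -> ebar U = lower_sum n.+1 f U.
  exists (fun I => if \dim I == n then ebar I else 0) => U dimU.
  by rewrite lower_sum_full.
(* Pairing [e] with the spread vector only sees the sums of [e] over the chambers with a given
   middle subspace. *)
suff sum0 : \sum_(U in S) ebar U = 0.
  apply/rowP => i; rewrite !mxE ord1 -[RHS]sum0.
  rewrite (reindex (@enum_rank (chamber F (2 * n)))); last by apply/onW_bij/enum_rank_bij.
  transitivity (\sum_(C : chamber F (2 * n) | chamber_nth C n \in S) e 0 (enum_rank C)).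
    rewrite [RHS]big_mkcond; apply: eq_bigr => C _.
    by rewrite mxE enum_rankK ratr_nat; case: (_ \in _); rewrite ?mulr1 ?mulr0.
  rewrite (partition_big (fun C => chamber_nth C n) (mem S)) //=.
  apply: eq_bigr => U SU; apply: eq_bigl => C.
  by case: eqP => [->|]; rewrite ?andbF ?SU.
(* If [lambda] is the extremal scalar, the descent stops at dimensions below [2]; otherwise no layer
   blocks it and [ebar] vanishes on [n]-subspaces. *)
have [lambda1|lambda1] := eqVneq lambda (kneser_eigenvalue R F n 1).
  have ne j : (2 <= j < 2 + n.-1)%N -> lambda != kneser_eigenvalue R F n j.
    by move=> lej; apply: lambda_ne; lia.
  have [|f fE] := kneser_eigenvector_lower_sum ne Kebar.
    by rewrite (_ : 2 + n.-1 = n.+1)%N; [exact: top | lia].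
  apply: (sum_spread_kneser_eigenvector1 n_gt0 S_spread fE) => U dimU.
  by rewrite -lambda1 Kebar.
have ne j : (0 <= j < 0 + n.+1)%N -> lambda != kneser_eigenvalue R F n j.
  by move=> /andP[_ ltj]; have [->//|] := eqVneq j 1%N; apply: lambda_ne.
have [f fE] := kneser_eigenvector_lower_sum ne Kebar top.
apply: big1 => U SU; rewrite fE ?dimS // /lower_sum big1 // => I.
by rewrite ltn0 andbF.
Qed.

End Main.

Theorem theorem3p6 (R : rcfType) (F : finFieldType) (n t : nat)
    (hn : (1 <= n)%N) (ht : (1 <= t)%N)
    (S : {set {vspace 'rV[F]_(2 * n)}}) (hS : fold_spread t S) :
  antidesign R (spread_vec S) /\
  \sum_(C : chamber F (2 * n)) spread_vec S C
    = t%:R * (#|F|%:R ^+ n + 1) * (num_chambers F n)%:R ^+ 2.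
Proof.
by split; [apply: antidesign_spread_vec hS | apply: sum_spread_vec].
Qed.
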